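(* Let $d\geq 2$. For every bounded convex $\mathcal{D}\subset\mathbb{R}^d$ with non-empty interior and every badly approximable $\alpha\in\mathbb{R}^d$, we have \[\sup_{R\geq 1} L(\alpha,R^{-1}\mathcal{D})<\infty .\]
   Context: $\alpha\in\mathbb{R}^d$ is badly approximable if there is $c>0$ such that $\|m\cdot\alpha\|_{\mathbb{R}/\mathbb{Z}}>c\|m\|^{-d}$ for all non-zero $m\in\mathbb{Z}^d$, where $\|x\|_{\mathbb{R}/\mathbb{Z}}$ is the distance from $x$ to the nearest integer. For a set $\mathcal{D}\subset\mathbb{R}^d$ and $q\in\mathcal{D}$, $\tau(q,\mathcal{D})=\min\{n\in\mathbb{N}^*\mid q+n\alpha\in\mathcal{D}+\mathbb{Z}^d\}$ with $\mathbb{N}^*=\{1,2,\ldots\}$, and $L(\alpha,\mathcal{D})$ is the number of distinct values of $\tau(q,\mathcal{D})$ as $q$ ranges over $\mathcal{D}$. $R^{-1}\mathcal{D}=\{R^{-1}x\mid x\in\mathcal{D}\}$. *)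

(* Defs.v *)
From HB Require Import structures.
From mathcomp Require Import all_boot all_order all_algebra.
From mathcomp Require Import mathcomp_extra boolp classical_sets reals.
Set Implicit Arguments. Unset Strict Implicit. Unset Printing Implicit Defensive.
Import Order.TTheory GRing.Theory Num.Theory.
Local Open Scope ring_scope.
Local Open Scope classical_set_scope.

Section Defs.
Variables (R : realType) (d : nat).

Definition distZ (x : R) : R :=
  Num.min (x - (Num.floor x)%:~R) ((Num.floor x + 1)%:~R - x).

Definition normZ (m : 'I_d -> int) : nat := \max_(i < d) `|m i|%N.

Definition dotZ (m : 'I_d -> int) (a : 'I_d -> R) : R :=
  \sum_(i < d) (m i)%:~R * a i.

Definition badly_approximable (a : 'I_d -> R) : Prop :=
  exists c : R, 0 < c /\
    forall m : 'I_d -> int, (exists i, m i != 0) ->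
      c * ((normZ m)%:R ^- d) < distZ (dotZ m a).

Definition convex_set (D : set ('I_d -> R)) : Prop :=
  forall x y, D x -> D y -> forall t : R, 0 <= t -> t <= 1 ->
    D (fun i => (1 - t) * x i + t * y i).

Definition bounded_set (D : set ('I_d -> R)) : Prop :=
  exists B : R, forall x, D x -> forall i, `|x i| <= B.

Definition nonempty_interior (D : set ('I_d -> R)) : Prop :=
  exists x : 'I_d -> R, exists e : R, 0 < e /\
    forall y : 'I_d -> R, (forall i, `|y i - x i| < e) -> D y.

Definition scale_inv (r : R) (D : set ('I_d -> R)) : set ('I_d -> R) :=
  [set (fun i => r^-1 * x i) | x in D].

Definition in_D_plus_Zd (D : set ('I_d -> R)) (y : 'I_d -> R) : Prop :=
  exists k : 'I_d -> int, D (fun i => y i - (k i)%:~R).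

Definition is_tau (a : 'I_d -> R) (D : set ('I_d -> R)) (q : 'I_d -> R) (n : nat) : Prop :=
  (0 < n)%N /\ in_D_plus_Zd D (fun i => q i + n%:R * a i) /\
  forall n' : nat, (0 < n')%N -> (n' < n)%N ->
    ~ in_D_plus_Zd D (fun i => q i + n'%:R * a i).

(* the set of values of tau(q, D), q ranging over D; L(a, D) is its cardinality *)
Definition tau_values (a : 'I_d -> R) (D : set ('I_d -> R)) : set nat :=
  [set n | exists2 q, D q & is_tau a D q n].

Definition L_le (a : 'I_d -> R) (D : set ('I_d -> R)) (M : nat) : Prop :=
  exists s : seq nat, (size s <= M)%N /\ forall n, tau_values a D n -> n \in s.

End Defs.

(* Main.v *)
Require Import Defs.
From HB Require Import structures.
From mathcomp Require Import all_boot all_order all_algebra.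
From mathcomp Require Import mathcomp_extra boolp classical_sets reals.
From mathcomp Require Import zify ring lra.
Set Implicit Arguments. Unset Strict Implicit. Unset Printing Implicit Defensive.
Import Order.TTheory GRing.Theory Num.Theory.
Local Open Scope ring_scope.

(* By transference, [a] badly approximable gives [n * |n a - k|^d > c] for all
   [n > 0]: the lattice of vectors [(n / X, (n a - k) / Y)] has no two points
   close together once [X * Y^d] is bounded.  By Dirichlet's pigeonhole the unit
   box contains more of these vectors than a separated set in a hyperplane can
   have, so they span, and rounding coordinates shows that the lattice has bounded
   covering radius; hence every return time to [D / r] is at most a constant times
   [r^d].  A return time [n] satisfies [|n a - k| <= 2 B / r] for some [k], and by
   separation only boundedly many [n] of that size do. *)

(** * Pigeonhole principles and the distance to the nearest integer *)

Lemma pigeonhole_fiber (T S : finType) (f : T -> S) (A : nat) :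
  (A * #|S| < #|T|)%N -> exists s, (A < #|[set x | f x == s]|)%N.
Proof.
move=> lt; apply/existsP; rewrite -[X in is_true X]negbK negb_exists.
apply/negP => /forallP le; move: lt; rewrite ltnNge => /negP; apply.
rewrite -sum1_card (partition_big f predT) //= mulnC -sum_nat_const.
apply: leq_sum => s _; have := le s; rewrite -leqNgt -sum1_card.
by under eq_bigl do rewrite inE.
Qed.

Lemma pigeonhole_collision (T S : finType) (f : T -> S) :
  (#|S| < #|T|)%N -> exists x y, x != y /\ f x = f y.
Proof.
rewrite -[#|S|]mul1n => /(pigeonhole_fiber f)[s /card_gt1P[x [y []]]].
by rewrite !inE => /eqP fx /eqP fy xy; exists x, y; rewrite fx fy.
Qed.

Lemma distZ_le (R : realType) (x : R) (k : int) : distZ x <= `|x - k%:~R|.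
Proof.
rewrite /distZ; have /andP[fl fr] := floor_itv x.
rewrite ge_min; have [kf|fk] := leP k (Num.floor x).
  have kf' : k%:~R <= (Num.floor x)%:~R :> R by rewrite ler_int.
  by rewrite (le_trans _ (ler_norm _)) // lerD2l lerN2.
have fk' : (Num.floor x + 1)%:~R <= k%:~R :> R by rewrite ler_int lezD1.
by apply/orP; right; rewrite distrC (le_trans _ (ler_norm _)) // lerD2r.
Qed.

(** * Transference from linear forms to simultaneous approximation *)

Lemma nat_root_bracket (d n : nat) : (0 < d)%N -> (0 < n)%N ->
  exists p, [/\ (0 < p)%N, (p ^ d <= n)%N & (n < p.+1 ^ d)%N].
Proof.
move=> d0 n0.
have ex : exists p, (p ^ d <= n)%N by exists 0%N; rewrite exp0n.
have ub p : (p ^ d <= n)%N -> (p <= n)%N.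
  by apply: leq_trans; case: p => // p; rewrite -{1}[p.+1]expn1 leq_pexp2l.
case: (ex_maxnP ex ub) => p pn pmax; exists p; split=> //.
  by apply: (leq_trans _ (pmax 1%N _)); rewrite ?exp1n.
by rewrite ltnNge; apply/negP => /pmax; rewrite ltnn.
Qed.

(** More than [n] vectors with entries in [0..p] share [n] residues of their product with [k]; [m]
    is the difference of two that collide. *)
Lemma small_solution_mod (d n : nat) (k : 'I_d -> int) :
  (0 < d)%N -> (0 < n)%N ->
  exists p (m : 'I_d -> int),
    [/\ (p ^ d <= n)%N, exists i, m i != 0, forall i, (`|m i| <= p)%N
      & exists z : int, \sum_i m i * k i = z * n%:Z].
Proof.
move=> d0 n0; have [p [p0 pn np]] := nat_root_bracket d0 n0.
pose f (g : {ffun 'I_d -> 'I_p.+1}) : 'I_n.-1.+1 :=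
  inord `|((\sum_i (g i : nat)%:Z * k i) %% n%:Z)%Z|%N.
have [|g [h [gh fgh]]] := @pigeonhole_collision _ _ f.
  by rewrite card_ffun !card_ord prednK.
exists p, (fun i => (g i : nat)%:Z - (h i : nat)%:Z); split=> //.
- apply/existsP; apply: contra_neqT gh; rewrite negb_exists => /forallP e.
  apply/ffunP => i; apply/val_inj => /=.
  by have := e i; rewrite negbK subr_eq0 => /eqP[].
- by move=> i; have := ltn_ord (g i); have := ltn_ord (h i); lia.
have n0' : n%:Z != 0 by rewrite eqz_nat -lt0n.
have ltn (x : int) : (`|(x %% n%:Z)%Z| < n.-1.+1)%N.
  by rewrite prednK // -ltz_nat gez0_abs ?modz_ge0 // ltz_pmod.
move/(congr1 (fun x : 'I_ _ => (val x)%:Z)) : fgh; rewrite /f /= !inordK //.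
rewrite !gez0_abs ?modz_ge0 // => /eqP; rewrite eqz_mod_dvd.
move/dvdzP => [z E]; exists z; rewrite -E -sumrB.
by apply: eq_bigr => i _; rewrite mulrBl.
Qed.

(* Khintchine's transference: if [n a] is close to the integer vector [k], any
   small [m] with [m . k = 0 mod n] makes [m . a] close to an integer. *)
Lemma badly_approximable_simultaneous (R : realType) (d : nat) (a : 'I_d -> R) :
  (0 < d)%N -> badly_approximable a ->
  exists2 c : R, 0 < c & forall (n : nat) (k : 'I_d -> int) (e : R),
    (0 < n)%N -> (forall i, `|n%:R * a i - (k i)%:~R| <= e) ->
    c < n%:R * e ^+ d.
Proof.
(* From [c / p^d < d p e / n] and [p^d <= n] comes [c / d < p e]; taking [d]-th powers and using
   [p^d <= n] once more gives this constant. *)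
move=> d0 [c [c0 hc]]; exists ((c / d%:R) ^+ d).
  by rewrite exprn_gt0 // divr_gt0 // ltr0n.
move=> n k e n0 ke.
have [p [m [pn mnz mp [z mk]]]] := small_solution_mod k d0 n0.
have nR : 0 < n%:R :> R by rewrite ltr0n.
have dR : 0 < d%:R :> R by rewrite ltr0n.
have e0 : 0 <= e by apply: le_trans (ke (Ordinal d0)).
have p0 : (0 < p)%N by have [i mi] := mnz; have := mp i; lia.
have pR : 0 < p%:R :> R by rewrite ltr0n.
have mpn : (normZ m <= p)%N by apply/bigmax_leqP => i _; exact: mp.
have mn0 : (0 < normZ m)%N.
  have [i mi] := mnz; rewrite (leq_trans _ (leq_bigmax i)) //; lia.
have lo : c * p%:R ^- d < distZ (dotZ m a).
  apply: le_lt_trans (hc m mnz); rewrite ler_pM2l // lef_pV2 ?posrE ?exprn_gt0 ?ltr0n //.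
  by rewrite lerXn2r ?nnegrE ?ler0n // ler_nat.
(* As [m . k = z n], the difference [m . a - z] is the sum of the [m i (n a i - k i)] divided by
   [n], and each summand is at most [p e] in absolute value. *)
have up : distZ (dotZ m a) <= d%:R * (p%:R * e) / n%:R.
  apply: (le_trans (distZ_le _ z)).
  rewrite ler_pdivlMr // -[X in _ * X]gtr0_norm // -normrM mulrBl.
  have -> : z%:~R * n%:R = \sum_i (m i)%:~R * (k i)%:~R :> R.
    under eq_bigr do rewrite -intrM.
    by rewrite -raddf_sum /= mk intrM.
  rewrite /dotZ mulr_suml -sumrB.
  apply: (le_trans (ler_norm_sum _ _ _)).
  have -> : d%:R * (p%:R * e) = \sum_(i < d) p%:R * e.
    by rewrite sumr_const card_ord mulr_natl.
  apply: ler_sum => i _.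
  rewrite -mulrA -mulrBr normrM [a i * _]mulrC ler_pM //.
  by rewrite -intr_norm -natr_absz ler_nat.
have := lt_le_trans lo up.
rewrite ltr_pdivrMr ?exprn_gt0 // mulrAC ltr_pdivlMr // => main.
have pdn : p%:R ^+ d <= n%:R :> R by rewrite -natrX ler_nat.
have cd : c / d%:R < p%:R * e.
  rewrite ltr_pdivrMr // mulrC -(ltr_pM2r nR) mulrC.
  apply: (lt_le_trans main); rewrite [_ * d%:R]mulrC ler_wpM2l //.
  by rewrite !mulr_ge0 // ler0n.
apply: (@lt_le_trans _ _ ((p%:R * e) ^+ d)).
  by rewrite ltrXn2r ?nnegrE ?divr_ge0 ?mulr_ge0 ?ltW // -lt0n.
by rewrite exprMn ler_wpM2r // exprn_ge0.
Qed.

(** * Separated points: counting, spanning and covering *)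

Lemma eq_floor_dist (R : realType) (x y : R) :
  Num.floor x = Num.floor y -> `|x - y| < 1.
Proof.
move=> e; have /andP[xl xr] := floor_itv x; have /andP[yl yr] := floor_itv y.
rewrite -e in yl yr; rewrite intrD in xr yr.
by rewrite ltr_norml; apply/andP; split; lra.
Qed.

(** A grid cell of side [1 / H] holds at most one point. The floors range over [-H..H], where [H]
    itself comes from the endpoint 1, whence [2 H + 1] cells per coordinate. *)
Lemma card_separated (R : realType) (T : finType) (F : {set T}) (N H : nat)
    (f : T -> 'I_N -> R) :
  (0 < H)%N ->
  (forall x i, x \in F -> `|f x i| <= 1) ->
  (forall x y, x \in F -> y \in F ->
    (forall i, `|f x i - f y i| < H%:R^-1) -> x = y) ->
  (#|F| <= (2 * H).+1 ^ N)%N.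
Proof.
move=> H0 fb fs; have HR : 0 < H%:R :> R by rewrite ltr0n.
pose cell x : {ffun 'I_N -> 'I_(2 * H).+1} :=
  [ffun i => inord (absz (Num.floor (H%:R * f x i) + H%:Z))].
have floorb x i : x \in F -> - H%:Z <= Num.floor (H%:R * f x i) <= H%:Z.
  move=> xF; have := fb x i xF; rewrite ler_norml => /andP[fl fr].
  rewrite floor_ge_int -ltzD1 floor_lt_int intrD intrN.
  by apply/andP; split; [nra|apply: (@le_lt_trans _ _ H%:R); [nra|rewrite ltrDl]].
have cinj : {in F &, injective cell}.
  move=> x y xF yF /ffunP e; apply: fs => // i.
  have := congr1 val (e i); rewrite !ffunE /=.
  have := floorb x i xF; have := floorb y i yF => by1 bx.
  rewrite !inordK; [|lia|lia] => efl.
  have /eq_floor_dist : Num.floor (H%:R * f x i) = Num.floor (H%:R * f y i) by lia.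
  by rewrite -mulrBr normrM gtr0_norm // -ltr_pdivlMl // mulr1.
by rewrite -(card_in_imset cinj) (leq_trans (max_card _)) // card_ffun !card_ord.
Qed.

(* Dropping the coordinate in which the normal [u] is largest is injective on the
   hyperplane, and shrinks distances by a factor at most [N]. *)
Lemma card_separated_hyperplane (R : realType) (T : finType) (F : {set T})
    (N H : nat) (v : T -> 'rV[R]_N.+1) (u : 'cV[R]_N.+1) :
  (0 < N)%N -> (0 < H)%N -> u != 0 ->
  (forall x, x \in F -> v x *m u = 0) ->
  (forall x i, x \in F -> `|v x 0 i| <= 1) ->
  (forall x y, x \in F -> y \in F ->
    (forall i, `|v x 0 i - v y 0 i| < H%:R^-1) -> x = y) ->
  (#|F| <= (2 * (N * H)).+1 ^ N)%N.
Proof.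
move=> N0 H0 u0 vu vb vs.
have NR : 1 <= N%:R :> R by rewrite ler1n.
have HR : 0 < H%:R :> R by rewrite ltr0n.
pose i0 := [arg max_(i > ord0) `|u i 0|]%O.
have umax j : `|u j 0| <= `|u i0 0|.
  by rewrite /i0; case: arg_maxP => // i _; apply.
have ui0 : 0 < `|u i0 0|.
  rewrite normr_gt0; apply: contra_neq u0 => e; apply/colP => j; rewrite mxE.
  by apply/normr0_eq0/le_anti; rewrite normr_ge0 (le_trans (umax j)) // e normr0.
apply: (@card_separated R T F N (N * H) (fun x j => v x 0 (lift i0 j))).
- by rewrite muln_gt0 N0.
- by move=> x i; apply: vb.
move=> x y xF yF hxy; apply: vs => // i.
have hxy' j : `|v x 0 (lift i0 j) - v y 0 (lift i0 j)| < H%:R^-1.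
  apply: lt_le_trans (hxy j) _; rewrite lef_pV2 ?posrE ?ltr0n ?muln_gt0 ?N0 //.
  by rewrite ler_nat leq_pmull.
case: (unliftP i0 i) => [j ->|->]; first exact: hxy'.
have : ((v x - v y) *m u) 0 0 = 0 by rewrite mulmxBl !vu // subrr mxE.
rewrite mxE (bigD1_ord i0) //= => /eqP; rewrite addr_eq0 => /eqP e.
rewrite -(ltr_pM2r ui0).
have -> : `|v x 0 i0 - v y 0 i0| * `|u i0 0| = `|(v x - v y) 0 i0 * u i0 0|.
  by rewrite normrM !mxE.
rewrite e normrN; apply: (le_lt_trans (ler_norm_sum _ _ _)).
apply: (@lt_le_trans _ _ (\sum_(j < N) (N * H)%:R^-1 * `|u i0 0|)).
  apply: ltr_sum; first by apply/hasP; exists (Ordinal N0); rewrite ?mem_index_enum.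
  move=> j _; rewrite normrM !mxE; apply: (@le_lt_trans _ _
    (`|v x 0 (lift i0 j) - v y 0 (lift i0 j)| * `|u i0 0|)).
    by rewrite ler_wpM2l.
  by rewrite ltr_pM2r.
rewrite sumr_const card_ord -mulrnAl ler_pM2r // natrM invfM -mulr_natl mulrA.
by rewrite mulfV ?mul1r // gt_eqF // (lt_le_trans ltr01).
Qed.

(** Too numerous for a hyperplane, the vectors span; rounding down the coordinates of [x] in a basis
    chosen among them costs at most 1 per basis vector. *)
Lemma integer_span_cover (R : realType) (T : finType) (F : {set T}) (N H : nat)
    (v : T -> 'rV[R]_N.+1) (x : 'rV[R]_N.+1) :
  (0 < N)%N -> (0 < H)%N ->
  ((2 * (N * H)).+1 ^ N < #|F|)%N ->
  (forall t i, t \in F -> `|v t 0 i| <= 1) ->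
  (forall s t, s \in F -> t \in F ->
    (forall i, `|v s 0 i - v t 0 i| < H%:R^-1) -> s = t) ->
  exists (t : 'I_N.+1 -> T) (c : 'I_N.+1 -> int),
    (forall j, t j \in F) /\
    forall i, `|\sum_j (c j)%:~R * v (t j) 0 i - x 0 i| <= N.+1%:R.
Proof.
move=> N0 H0 Fbig vb vs.
pose A := \matrix_(i < #|F|) v (enum_val i).
have [full|] := boolP (row_full A); last first.
  (* If the vectors did not span, a non-zero column of the cokernel would be normal to all of them,
     and the hyperplane bound would contradict the size of [F]. *)
  rewrite -cokermx_eq0 => cok0.
  have [j uj0] : exists j, col j (cokermx A) != 0.
    apply/existsP; apply: contra_neqT cok0; rewrite negb_exists => /forallP e.
    apply/matrixP => i j; have := e j; rewrite negbK => /eqP/colP/(_ i).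
    by rewrite !mxE.
  exfalso; move: Fbig; apply/negP; rewrite -leqNgt.
  apply: (card_separated_hyperplane N0 H0 uj0 _ vb vs) => t tF.
  have := mulmx_coker A => /(congr1 (row (enum_rank_in tF t))).
  rewrite row_mul rowK enum_rankK_in // row0 => e.
  by rewrite colE mulmxA e mul0mx.
pose f := fullrankfun full; pose B := rowsub f A.
pose c := x *m invmx B.
exists (fun j => enum_val (f j)), (fun j => Num.floor (c 0 j)).
split=> [j|i]; first exact: enum_valP.
have -> : x 0 i = \sum_j c 0 j * v (enum_val (f j)) 0 i.
  rewrite -{1}[x](mulmxKV (fullrowsub_unit full)) mxE.
  by apply: eq_bigr => j _; rewrite !mxE.
rewrite -sumrB; apply: (le_trans (ler_norm_sum _ _ _)).
have -> : N.+1%:R = \sum_(j < N.+1) 1 :> R by rewrite sumr_const card_ord.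
apply: ler_sum => j _; rewrite -mulrBl normrM.
rewrite -[1]mulr1 ler_pM ?vb ?enum_valP //.
have /andP[fl fr] := floor_itv (c 0 j); rewrite intrD in fr.
by rewrite ler_norml; apply/andP; split; lra.
Qed.

(** * Separation of the rescaled approximation vectors *)

(* [(n, theta)] rescaled by [(X, Y)], with [n] in coordinate 0. *)
Definition approx_vec (R : realType) (d : nat) (X Y : R) (n : R) (theta : 'I_d -> R)
    (i : 'I_d.+1) : R :=
  if unlift ord0 i is Some j then theta j / Y else n / X.

Lemma approx_vec0 (R : realType) (d : nat) (X Y n : R) (theta : 'I_d -> R) :
  approx_vec X Y n theta ord0 = n / X.
Proof. by rewrite /approx_vec unlift_none. Qed.

Lemma approx_vecS (R : realType) (d : nat) (X Y n : R) (theta : 'I_d -> R) j :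
  approx_vec X Y n theta (lift ord0 j) = theta j / Y.
Proof. by rewrite /approx_vec liftK. Qed.

(** For [t < s], the difference of two such vectors comes from [s - t] and [ks - kt]. Were it
    smaller than [1 / H], then [n = s - t] and [e = Y / H] would give
    [n e^d <= X Y^d / H^(d+1) <= c], against the first hypothesis. *)
Lemma approx_vec_separated (R : realType) (d : nat) (a : 'I_d -> R) (c X Y : R) (H : nat) :
  (forall (n : nat) (k : 'I_d -> int) (e : R),
    (0 < n)%N -> (forall i, `|n%:R * a i - (k i)%:~R| <= e) -> c < n%:R * e ^+ d) ->
  0 < X -> 0 < Y -> (0 < H)%N -> X * Y ^+ d <= c * H%:R ^+ d.+1 ->
  forall (s t : nat) (ks kt : 'I_d -> int),
    (forall i, `|approx_vec X Y s%:R (fun j => s%:R * a j - (ks j)%:~R) i -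
                 approx_vec X Y t%:R (fun j => t%:R * a j - (kt j)%:~R) i| < H%:R^-1) ->
    s = t.
Proof.
move=> sep X0 Y0 H0 XY; have HR : 0 < H%:R :> R by rewrite ltr0n.
suff main (s t : nat) (ks kt : 'I_d -> int) :
    (forall i, `|approx_vec X Y s%:R (fun j => s%:R * a j - (ks j)%:~R) i -
                 approx_vec X Y t%:R (fun j => t%:R * a j - (kt j)%:~R) i| < H%:R^-1) ->
    ~ (t < s)%N.
  move=> s t ks kt h; case: (ltngtP s t) => // lt; exfalso.
    by apply: (main t s kt ks) lt => i; rewrite distrC.
  exact: (main s t ks kt h lt).
move=> h ts.
have h0 : (s - t)%:R <= X / H%:R.
  have := h ord0; rewrite !approx_vec0 -mulrBl normrM normfV (gtr0_norm X0).
  rewrite ltr_pdivrMr // [_^-1 * _]mulrC => /ltW; apply: le_trans.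
  by rewrite natrB ?ler_norm // ltnW.
have hj j : `|(s - t)%:R * a j - (ks j - kt j)%:~R| <= Y / H%:R.
  have := h (lift ord0 j); rewrite !approx_vecS -mulrBl normrM normfV (gtr0_norm Y0).
  rewrite ltr_pdivrMr // [_^-1 * _]mulrC => /ltW; apply: le_trans.
  rewrite natrB ?(ltnW ts) // intrB.
  by rewrite le_eqVlt; apply/orP; left; apply/eqP; congr (`| _ |); ring.
have st0 : (0 < s - t)%N by rewrite subn_gt0.
have := sep _ _ _ st0 hj; apply/negP; rewrite -leNgt.
apply: (@le_trans _ _ (X / H%:R * (Y / H%:R) ^+ d)).
  by rewrite ler_wpM2r // exprn_ge0 // divr_ge0 // ltW.
by rewrite expr_div_n mulrACA -invfM -exprS ler_pdivrMr // exprn_gt0.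
Qed.

(** * Quantitative density of the multiples of [a] modulo integer vectors *)

Lemma badly_approximable_dense (R : realType) (d : nat) (a : 'I_d -> R) :
  (0 < d)%N -> badly_approximable a ->
  exists2 A : nat, (0 < A)%N &
    forall (J : nat) (y : 'I_d -> R), (0 < J)%N ->
      exists (n : nat) (k : 'I_d -> int),
        [/\ (0 < n)%N, (n <= A * J ^ d)%N
          & forall i, `|n%:R * a i - (k i)%:~R - y i| <= d.+1%:R / J%:R].
Proof.
move=> d0 ba; have [c c0 sep] := badly_approximable_simultaneous d0 ba.
(* [A] will be the hyperplane bound for [H]. Since [2 d H + 1 <= 3 d H], it is at most [(3 d H)^d],
   and the spare factor of [H^(d+1)] beats [(3 d)^d / c], so [A <= c H^(d+1)]. *)
pose H := (Num.bound ((3 * d)%:R ^+ d / c)).+1.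
have HR : 0 < H%:R :> R by rewrite ltr0n.
pose A := ((2 * (d * H)).+1 ^ d)%N.
have A0 : (0 < A)%N by rewrite expn_gt0.
have AH : A%:R <= c * H%:R ^+ d.+1.
  apply: (@le_trans _ _ ((3 * d)%:R ^+ d * H%:R ^+ d)).
    rewrite -exprMn -natrM -natrX ler_nat leq_exp2r //.
    have : (0 < d * H)%N by rewrite muln_gt0 d0.
    lia.
  rewrite exprS [c * _]mulrA ler_wpM2r ?exprn_ge0 //.
  rewrite mulrC -ler_pdivrMr //.
  have b0 : 0 <= (3 * d)%:R ^+ d / c by rewrite divr_ge0 ?exprn_ge0 ?ler0n ?(ltW c0).
  by rewrite (le_trans (ltW (archi_boundP b0))) // ler_nat.
exists ((2 * d).+3 * A)%N; first by rewrite muln_gt0.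
move=> J y J0; have JR : 0 < J%:R :> R by rewrite ltr0n.
(* Distributing [Q + 1] multiples of [a] over [J^d] cells puts more than [A] into one cell; with
   [X = Q] and [Y = 1 / J], the product [X Y^d] is exactly [A]. *)
pose Q := (A * J ^ d)%N.
have Q0 : (0 < Q)%N by rewrite muln_gt0 A0 expn_gt0 J0.
have QR : 0 < Q%:R :> R by rewrite ltr0n.
pose T := 'I_Q.+1.
pose kf (t : nat) (j : 'I_d) : int := Num.floor (t%:R * a j).
pose th (t : nat) (j : 'I_d) : R := t%:R * a j - (kf t j)%:~R.
pose cell (t : T) : {ffun 'I_d -> 'I_J.-1.+1} :=
  [ffun j => inord (absz (Num.floor (J%:R * th t j)))].
have [s] : exists s, (A < #|[set t | cell t == s]|)%N.
  by apply: pigeonhole_fiber; rewrite card_ffun !card_ord prednK // ltnS.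
set F := [set t | _] => AF.
have [t0 t0F] : exists t0, t0 \in F by apply/set0Pn; rewrite -card_gt0 (leq_trans _ AF).
pose w (t : T) := approx_vec Q%:R J%:R^-1 (t : nat)%:R (th t).
(* Translating by the vector of [t0] brings the points of the cell into the unit box and leaves
   their differences unchanged. *)
pose v (t : T) : 'rV[R]_d.+1 := \row_i (w t i - w t0 i).
have thJ t j : 0 <= J%:R * th t j < J%:R.
  have /andP[fl fr] := floor_itv (t%:R * a j); rewrite intrD in fr.
  have th0 : 0 <= th t j by rewrite subr_ge0.
  have th1 : th t j < 1 by rewrite ltrBlDl.
  by rewrite mulr_ge0 ?(ltW JR) //= gtr_pMr.
have vb t i : t \in F -> `|v t 0 i| <= 1.
  move=> tF; rewrite mxE /w; case: (unliftP ord0 i) => [j|] ->.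
    rewrite !approx_vecS !invrK -mulrBl mulrC mulrBr; apply: ltW.
    apply: eq_floor_dist; move: tF t0F; rewrite !inE => /eqP <- /eqP e.
    move/ffunP/(_ j)/(congr1 val): e; rewrite !ffunE /=.
    have fb u : 0 <= Num.floor (J%:R * th u j) < J%:Z.
      have /andP[l r] := thJ u j.
      by rewrite floor_ge0 l floor_lt_int.
    have := fb t; have := fb t0 => b1 b2.
    rewrite !inordK; [|lia|lia] => e.
    case/andP: b1 => p0 _; case/andP: b2 => p1 _.
    by rewrite -(gez0_abs p0) -(gez0_abs p1) e.
  rewrite !approx_vec0 -mulrBl normrM normfV (gtr0_norm QR) ler_pdivrMr // mul1r.
  have tQ : t%:R <= Q%:R :> R by rewrite ler_nat -ltnS.
  have tQ0 : t0%:R <= Q%:R :> R by rewrite ler_nat -ltnS.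
  have p1 : 0 <= t%:R :> R by []; have p2 : 0 <= t0%:R :> R by [].
  by rewrite ler_norml; apply/andP; split; lra.
have vs s' t : s' \in F -> t \in F ->
    (forall i, `|v s' 0 i - v t 0 i| < H%:R^-1) -> s' = t.
  move=> _ _ h; apply/val_inj.
  apply: (@approx_vec_separated R d a c Q%:R J%:R^-1 H sep QR _ _ _ s' t (kf s') (kf t)).
  - by rewrite invr_gt0.
  - by [].
  - by rewrite natrM natrX exprVn mulfK // gt_eqF // exprn_gt0.
  move=> i; have := h i; rewrite !mxE.
  by rewrite opprB addrA subrK.
(* The covering error is at most [d + 1], so aiming at [d + 2] in coordinate 0 keeps [n / Q] between
   1 and [2 d + 3]: this makes [n] positive and explains the factor in the witness. *)
pose x : 'rV[R]_d.+1 := \row_i approx_vec 1 J%:R^-1 d.+2%:R y i.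
have [t [z [tF tz]]] := @integer_span_cover R T F d H v x d0 isT AF vb vs.
pose n := \sum_j z j * ((t j : nat)%:Z - (t0 : nat)%:Z).
pose k i := \sum_j z j * (kf (t j) i - kf t0 i).
have := tz ord0; rewrite mxE approx_vec0 divr1.
have -> : \sum_j (z j)%:~R * v (t j) 0 ord0 = n%:~R / Q%:R.
  rewrite rmorph_sum /= mulr_suml; apply: eq_bigr => j _.
  by rewrite mxE /w !approx_vec0 -mulrBl mulrA intrM intrB.
rewrite ler_norml => /andP[nl nr].
have nl' : Q%:R <= n%:~R :> R.
  rewrite -[X in X <= _]mul1r -ler_pdivlMr //.
  by move: nl; rewrite -[d.+2%:R]natr1; lra.
have nr' : n%:~R <= ((2 * d).+3 * Q)%:R :> R.
  rewrite natrM -ler_pdivrMr //; move: nr; rewrite -!natr1 natrM; lra.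
have n0 : Q%:Z <= n by rewrite -(ler_int R).
have nb : n <= ((2 * d).+3 * Q)%N%:Z by rewrite -(ler_int R).
have nE : (absz n)%:R = n%:~R :> R by rewrite natr_absz gtr0_norm //; lia.
exists (absz n), k; split.
- by lia.
- by rewrite -mulnA -/Q; lia.
move=> i; rewrite nE.
have := tz (lift ord0 i); rewrite mxE approx_vecS invrK.
have -> : \sum_j (z j)%:~R * v (t j) 0 (lift ord0 i) = (n%:~R * a i - (k i)%:~R) * J%:R.
  rewrite !rmorph_sum /= mulr_suml -sumrB mulr_suml; apply: eq_bigr => j _.
  rewrite mxE /w !approx_vecS invrK -mulrBl mulrA /th !intrM !intrB.
  by rewrite -!pmulrn; ring.
by rewrite -mulrBl normrM (gtr0_norm JR) -ler_pdivlMr.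
Qed.

(** * Return times: an upper bound of order [r^d], then a count *)

Theorem theorem1p6 (R : realType) (d : nat) (hd : (2 <= d)%N)
  (D : set ('I_d -> R)) (a : 'I_d -> R) :
  bounded_set D -> convex_set D -> nonempty_interior D ->
  badly_approximable a ->
  exists M : nat, forall r : R, 1 <= r -> L_le a (scale_inv r D) M.
Proof.
move=> [B0 DB] _ [x0 [e [e0 De]]] ba; have d0 : (0 < d)%N by rewrite (ltn_trans _ hd).
pose B := Num.max B0 1.
have B1 : 0 < B by rewrite lt_max ltr01 orbT.
have {}DB x i : D x -> `|x i| <= B by move=> Dx; rewrite le_max DB.
have [c c0 sep] := badly_approximable_simultaneous d0 ba.
have [A A0 dense] := badly_approximable_dense d0 ba.
(* [C1] gives [J <= C1 r], as [r >= 1] absorbs the rounding. Then [bd] bounds [X Y^d] for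
   [X = A J^d] and [Y = 2 B / r]: the powers of [r] cancel, so [H] is independent of [r]. *)
pose C1 : R := d.+1%:R / e + 1.
have C10 : 0 < C1 by rewrite addr_gt0 // divr_gt0.
pose bd := A%:R * C1 ^+ d * (2 * B) ^+ d.
have bd0 : 0 <= bd by rewrite !mulr_ge0 ?exprn_ge0 ?mulr_ge0 ?ler0n ?(ltW C10) ?(ltW B1).
pose H := (Num.bound (bd / c)).+1.
exists ((2 * H).+1 ^ d.+1)%N => r r1; have r0 : 0 < r by apply: lt_le_trans r1.
have bdH : bd <= c * H%:R ^+ d.+1.
  rewrite mulrC -ler_pdivrMr //.
  have b0 : 0 <= bd / c by rewrite divr_ge0 // ltW.
  apply: (@le_trans _ _ H%:R); first by rewrite (le_trans (ltW (archi_boundP b0))) // ler_nat.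
  by rewrite exprS ler_peMr // exprn_ege1 // ler1n.
(* Fine enough for [(d + 1) / J < e / r], the half-side of a cube inside the scaled set. *)
pose J := (Num.truncn (d.+1%:R * r / e)).+1.
have JR : 0 < J%:R :> R by rewrite ltr0n.
have Jlo : d.+1%:R / J%:R < e / r.
  rewrite ltr_pdivrMr // mulrAC ltr_pdivlMr // mulrC [e * _]mulrC -ltr_pdivrMr //.
  by rewrite [r * _]mulrC truncnS_gt.
have Jup : J%:R <= C1 * r.
  have : 0 <= d.+1%:R * r / e by rewrite divr_ge0 ?mulr_ge0 ?ler0n ?(ltW r0) ?(ltW e0).
  move=> /truncn_itv/andP[l _]; rewrite /J -natr1 mulrDl mul1r.
  by rewrite lerD // (le_trans l) // mulrAC.
pose Q := (A * J ^ d)%N.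
have Q0 : (0 < Q)%N by rewrite muln_gt0 A0 expn_gt0.
have QR : 0 < Q%:R :> R by rewrite ltr0n.
have Y0 : 0 < 2 * B / r by rewrite divr_gt0 // mulr_gt0.
pose close (n : nat) (k : 'I_d -> int) :=
  forall i, `|n%:R * a i - (k i)%:~R| <= 2 * B / r.
pose F : {set 'I_Q.+1} := [set n : 'I_Q.+1 | `[< exists k, close n k >]].
have /choice[kf kfP] (n : 'I_Q.+1) : exists k, n \in F -> close n k.
  have [|nF] := boolP (n \in F); last by exists (fun=> 0).
  by rewrite inE => /asboolP[k hk]; exists k.
exists [seq val n | n <- enum F]; split.
  rewrite size_map -cardE.
  apply: (@card_separated R _ F d.+1 H (fun n =>
    approx_vec Q%:R (2 * B / r) (n : nat)%:R (fun j => n%:R * a j - (kf n j)%:~R))) => //.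
    move=> n i nF; case: (unliftP ord0 i) => [j|] ->.
      by rewrite approx_vecS normrM normfV (gtr0_norm Y0) ler_pdivrMr // mul1r kfP.
    rewrite approx_vec0 ger0_norm ?divr_ge0 // ler_pdivrMr // mul1r ler_nat.
    by rewrite -ltnS.
  move=> m n _ _ h; apply/val_inj.
  apply: (@approx_vec_separated R d a c Q%:R (2 * B / r) H sep QR Y0 isT _ m n (kf m) (kf n) h).
  apply: le_trans bdH; rewrite natrM natrX expr_div_n mulrA ler_pdivrMr ?exprn_gt0 //.
  rewrite /bd [leRHS]mulrAC ler_wpM2r ?exprn_ge0 ?mulr_ge0 ?ler0n ?(ltW B1) //.
  rewrite -mulrA ler_wpM2l // -exprMn lerXn2r // nnegrE ?ler0n //.
  by rewrite mulr_ge0 // ltW.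
move=> n [q [x Dx qE] [n0 [[k [x' Dx' x'E]] nmin]]].
have qx i : q i = r^-1 * x i by rewrite -qE.
(* Density puts some [q + n' a - k'] with [n' <= Q] into the cube about [x0 / r]; minimality of [n]
   forces [n <= n']. *)
have nQ : (n <= Q)%N.
  have [n' [k' [n'0 n'Q hk']]] := @dense J (fun i => r^-1 * x0 i - q i) isT.
  apply: leq_trans n'Q; rewrite leqNgt; apply/negP => lt.
  apply: (nmin n' n'0 lt); exists k'.
  exists (fun i => r * (q i + n'%:R * a i - (k' i)%:~R)); last first.
    by apply/funext => i; rewrite mulrA mulVf ?mul1r // gt_eqF.
  apply: De => i; have := le_lt_trans (hk' i) Jlo.
  rewrite ltr_pdivlMr // -[X in _ * X](gtr0_norm r0) -normrM; congr (`| _ | < _).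
  by rewrite mulrC; field; rewrite gt_eqF.
have nQ' : (n < Q.+1)%N by rewrite ltnS.
apply/mapP; exists (Ordinal nQ') => //; rewrite mem_enum inE; apply/asboolP.
(* Both [q] and [q + n a - k] lie in the scaled set, whose points have coordinates at most [B / r]
   in absolute value. *)
exists k => i /=; have := congr1 (fun f => f i) x'E; rewrite /= qx => xk.
have -> : n%:R * a i - (k i)%:~R = r^-1 * (x' i - x i).
  by rewrite mulrBr xk; ring.
rewrite normrM normfV (gtr0_norm r0) mulrC ler_wpM2r ?invr_ge0 ?(ltW r0) //.
by rewrite (le_trans (ler_normB _ _)) // mulr_natl mulr2n lerD ?DB.
Qed.
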